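(* Let $n\in\mathbb{N}$ and $p_1,\dots,p_n\in(0,\tfrac12]$. Let $h(x)=Ax+b$ be drawn from the family $\mathcal{H}_{\{p_i\}}(n,n)$, and fix $\alpha\in\{0,1\}^n$. Then for every $1\le m\le n$ and every nonempty $S\subseteq\{0,1\}^n$, $$\frac{\sigma^2[\mathrm{Cnt}_m(S)]}{\mathsf{E}[\mathrm{Cnt}_m(S)]}\;\le\;\sum_{w=0}^{\ell} 2\cdot\left(\frac{8e\sqrt{n\cdot \ell}}{w}\right)^{w} r(w,m),$$ where $\ell=\lceil \log_2|S|\rceil$ and the $w=0$ term of the sum is interpreted as $2\,r(0,m)$.
   Context: All arithmetic on vectors is over $\mathbb{F}_2$. The family $\mathcal{H}_{\{p_i\}}(n,n)$ consists of the random functions $h:\{0,1\}^n\to\{0,1\}^n$, $h(x)=Ax+b$, where $A\in\mathbb{F}_2^{n\times n}$, $b\in\mathbb{F}_2^{n}$, all entries are independent, each entry of the $i$-th row of $A$ is distributed as Bernoulli$(p_i)$ (equal to $1$ with probability $p_i$), and each entry of $b$ is Bernoulli$(1/2)$. For $1\le m\le n$, $h^{(m)}(x)=A^{(m)}x+b^{(m)}$, where $A^{(m)}$ consists of the first $m$ rows of $A$ and $b^{(m)}$ of the first $m$ entries of $b$; $\alpha^{(m)}$ denotes the first $m$ coordinates of $\alpha$. For $S\subseteq\{0,1\}^n$, $\mathrm{Cnt}_m(S)=|\{y\in S: h^{(m)}(y)=\alpha^{(m)}\}|$, a random variable over the choice of $h$. Define $q(w,m)=\prod_{j=1}^{m}\left(\tfrac12+\tfrac12(1-2p_j)^w\right)$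 (with $0^0=1$) and $r(w,m)=q(w,m)-2^{-m}$. $\sigma^2$ denotes variance and $\mathsf{E}$ expectation. *)

(* Defs.v *)
From HB Require Import structures.
From mathcomp Require Export all_boot all_order all_algebra.
From mathcomp Require Export all_classical all_reals all_analysis.

Set Implicit Arguments.
Unset Strict Implicit.
Unset Printing Implicit Defensive.

Export Order.TTheory GRing.Theory Num.Theory.

Local Open Scope ring_scope.

Definition mutually_independent (d : measure_display) (T : measurableType d)
    (R : realType) (P : probability T R) (d' : measure_display)
    (V : measurableType d') (K : finType) (X : K -> {RV P >-> V}) : Prop :=
  forall (J : {set K}) (E : K -> set V), (forall k, measurable (E k)) ->
    (P (\bigcap_(k in [set` J]) (X k @^-1` E k))%classic
     = \prod_(k in J) P (X k @^-1` E k)%classic)%E.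

(* Entries are bool-valued so that they can be Bernoulli in the library's
   sense; they are cast to 'F_2 in [hash_mx] and [hash_cst]. *)
Record sparse_hash (d : measure_display) (T : measurableType d)
    (R : realType) (P : probability T R) (n : nat) (p : 'I_n -> R) :=
  SparseHash {
    entryA : 'I_n * 'I_n -> {RV P >-> bool};
    entryb : 'I_n -> {RV P >-> bool};
    entry_indep : mutually_independent
      (fun k : 'I_n * 'I_n + 'I_n =>
         match k with inl ij => entryA ij | inr i => entryb i end);
    entryA_distr : forall i j,
      distribution P (entryA (i, j)) =1 bernoulli_prob (p i);
    entryb_distr : forall i,
      distribution P (entryb i) =1 bernoulli_prob 2^-1 }.

Section SparseHash.
Variables (d : measure_display) (T : measurableType d) (R : realType).
Variables (P : probability T R) (n : nat) (p : 'I_n -> R).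
Implicit Types (h : sparse_hash P p) (t : T) (m : nat).

Definition hash_mx h t : 'M['F_2]_n := \matrix_(i, j) (entryA h (i, j) t)%:R.

Definition hash_cst h t : 'cV['F_2]_n := \col_i (entryb h i t)%:R.

Definition first_rows m k (hmn : (m <= n)%N) (M : 'M['F_2]_(n, k)) :
    'M['F_2]_(m, k) :=
  rowsub (widen_ord hmn) M.

Definition hash_prefix h m (hmn : (m <= n)%N) t (x : 'cV['F_2]_n) :
    'cV['F_2]_m :=
  first_rows hmn (hash_mx h t) *m x + first_rows hmn (hash_cst h t).

Definition Cnt h m (hmn : (m <= n)%N) (alpha : 'cV['F_2]_n)
    (S : {set 'cV['F_2]_n}) : T -> R :=
  fun t => #|[set y in S | hash_prefix h hmn t y == first_rows hmn alpha]%SET|%:R.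

End SparseHash.

Section Weights.
Variables (R : realType) (n : nat) (p : 'I_n -> R).

Definition q (w m : nat) (hmn : (m <= n)%N) : R :=
  \prod_(j < m) (2^-1 + 2^-1 * (1 - 2 * p (widen_ord hmn j)) ^+ w).

Definition r (w m : nat) (hmn : (m <= n)%N) : R := q w hmn - 2 ^- m.

End Weights.

(* Main.v *)
Require Import Defs.
From mathcomp Require Import ring lra zify.

(* Expanding the count into indicators, every row of [A] contributes
   independently, and the ratio variance / expectation is the average over
   [x] in [S] of the sum over [y] in [S] of [r (d(x, y), m)], where [d] is the
   Hamming distance and [r] is nonnegative and nonincreasing in [d].

   Down-compression in a coordinate (replacing [X] by [X] minus [i] whenever the
   latter is missing) preserves the size of a family of sets and does not
   decrease the sum of [g (d(X, Y))] over pairs, for any nonincreasing [g].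
   Hence [S] may be taken to be a down-set, all of whose members have at most
   [l = up_log 2 #|S|] elements.  For such an [X], an exponential Markov
   argument bounds the number of [Y] with [d(X, Y) = w] and
   [#|Y\X| <= #|X\Y|] by [(2 e sqrt (n l) / w) ^ w], and by symmetry such pairs
   make up at least half of all pairs at distance [w].  Pairs at distance
   at least [l] are bounded trivially, by [#|S| * 2 ^ l]. *)

Local Open Scope ring_scope.

Set Implicit Arguments.
Unset Strict Implicit.
Unset Printing Implicit Defensive.

(** * Down-compression of set families *)

Section Compression.
Variables (R : realDomainType) (I : finType).
Implicit Types (i j : I) (X Y : {set I}) (F : {set {set I}}) (g : nat -> R).

Definition hdist X Y : nat := #|[set j | (j \in X) != (j \in Y)]%SET|.

(** The symmetric difference of [X] with the singleton of [i]. Being an involution, it lets sums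
    over all sets be reindexed. *)
Definition toggle i X : {set I} := [set j | (j == i) (+) (j \in X)]%SET.

(** Given by its trace on each pair [X], [toggle i X]: a lone member becomes the one without [i],
    and a pair with no or two members is kept. *)
Definition compress i F : {set {set I}} :=
  [set X : {set I} | if i \in X then (X \in F) && (toggle i X \in F)
           else (X \in F) || (toggle i X \in F)]%SET.

Definition energy g F : R := \sum_(X in F) \sum_(Y in F) g (hdist X Y).

Lemma toggleK i : involutive (toggle i).
Proof. by move=> X; apply/setP => j; rewrite !inE addbA addbb. Qed.

Lemma in_toggle i X : (i \in toggle i X) = (i \notin X).
Proof. by rewrite inE eqxx. Qed.

Lemma hdist_toggle2 i X Y : hdist (toggle i X) (toggle i Y) = hdist X Y.
Proof.
rewrite /hdist; congr #|pred_of_set _|; apply/setP => j; rewrite !inE.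
by case: (j == i) (j \in X) (j \in Y) => [] [] [].
Qed.

Lemma hdist_toggler i X Y : hdist X (toggle i Y) = hdist (toggle i X) Y.
Proof. by rewrite -(hdist_toggle2 i) toggleK. Qed.

Lemma hdist_toggle i X Y :
  (i \in X) = (i \in Y) -> hdist (toggle i X) Y = (hdist X Y).+1.
Proof.
move=> XY; rewrite /hdist.
rewrite (cardsD1 i) inE in_toggle XY.
rewrite (_ : ~~ _ != _) ?add1n; last by case: (i \in Y).
congr (#|pred_of_set _|).+1; apply/setP => j; rewrite !inE.
by have [->|//] := eqVneq j i; rewrite XY eqxx.
Qed.

Lemma sum_toggle (V : nmodType) i (f : {set I} -> V) :
  (\sum_X f X) *+ 2 = \sum_X (f X + f (toggle i X)).
Proof.
rewrite big_split/= mulr2n; congr (_ + _).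
exact: reindex_inj (inv_inj (toggleK i)).
Qed.

(** Each pair [X], [toggle i X] keeps its number of members; summing over all [X] counts every pair
    twice, hence the doubling. *)
Lemma card_compress i F : #|compress i F| = #|F|.
Proof.
have E (G : {set {set I}}) : #|G|.*2
    = (\sum_X ((X \in G) + (toggle i X \in G)))%N.
  transitivity ((\sum_X (X \in G : nat)) *+ 2); last exact: sum_toggle.
  rewrite mulr2n -addnn -sum1_card big_mkcond/=.
  by congr (_ + _)%N; apply: eq_bigr => X _; case: ifP.
apply: double_inj; rewrite !E; apply: eq_bigr => X _.
rewrite !inE eqxx toggleK addTb.
by case: (i \in X) (X \in F) (toggle i X \in F) => [] [] [].
Qed.

Lemma sum_mem (f : {set I} -> R) F :
  \sum_(X in F) f X = \sum_X (X \in F)%:R * f X.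
Proof.
by rewrite big_mkcond; apply: eq_bigr => X _; case: ifP; rewrite ?mul1r ?mul0r.
Qed.

Lemma sum_toggle2 i (f : {set I} -> {set I} -> R) :
  (\sum_X \sum_Y f X Y) *+ 4 =
  \sum_X \sum_Y (f X Y + f X (toggle i Y)
                 + (f (toggle i X) Y + f (toggle i X) (toggle i Y))).
Proof.
rewrite (mulrnA _ 2 2) (sum_toggle i) -sumrMnl; apply: eq_bigr => X _.
by rewrite -big_split (sum_toggle i); apply: eq_bigr => Y _; rewrite addrACA.
Qed.

Lemma energyE g F : energy g F =
  \sum_X \sum_Y (X \in F)%:R * (Y \in F)%:R * g (hdist X Y).
Proof.
rewrite /energy sum_mem; apply: eq_bigr => X _.
by rewrite sum_mem mulr_sumr; apply: eq_bigr => Y _; rewrite mulrA.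
Qed.

(* Averaging over the four toggles of a pair [(X, Y)] leaves a pointwise
   inequality between the traces of [F] on two lines in direction [i]. *)
Lemma energy_compress g i F : {homo g : a b / (a <= b)%N >-> b <= a} ->
  energy g F <= energy g (compress i F).
Proof.
move=> gle; rewrite -(@ler_pMn2r _ 4)// !energyE !(sum_toggle2 i).
apply: ler_sum => X _; apply: ler_sum => Y _.
rewrite !hdist_toggle2 !hdist_toggler !inE !eqxx !toggleK !addTb.
(* Only two distances remain, and they differ by one: the shorter joins the sets that agree at
   [i]. *)
have [XY|XY] := eqVneq (i \in X) (i \in Y).
  have := gle _ _ (leqnSn (hdist X Y)); rewrite (hdist_toggle XY) XY.
  move: (g _) (g _) => u v uv.
  by case: (i \in Y) (X \in F) (Y \in F) (toggle i X \in F) (toggle i Y \in F)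
    => [] [] [] [] [] /=; lra.
have XY' : (i \in toggle i X) = (i \in Y).
  by rewrite in_toggle; case: (i \in X) (i \in Y) XY => [] [].
have := hdist_toggle XY'; rewrite toggleK => ->.
have := gle _ _ (leqnSn (hdist (toggle i X) Y)).
move: XY; move: (g _) (g _) => u v XY uv.
by move: XY; case: (i \in X) (i \in Y) (X \in F) (Y \in F) (toggle i X \in F)
  (toggle i Y \in F) => [] [] [] [] [] [] //= _; lra.
Qed.

(** The descent behind [exists_down_closed]: no pair gains total size, and the pair of [X] loses one
    element. *)
Lemma compress_weight i F X : X \in F -> i \in X -> toggle i X \notin F ->
  (\sum_(Y in compress i F) #|Y| < \sum_(Y in F) #|Y|)%N.
Proof.
move=> XF iX tXF.
have E (G : {set {set I}}) : (\sum_(Y in G) #|Y|).*2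
    = (\sum_Y ((Y \in G) * #|Y| + (toggle i Y \in G) * #|toggle i Y|))%N.
  transitivity ((\sum_Y ((Y \in G) * #|Y|)%N) *+ 2); last exact: sum_toggle.
  rewrite mulr2n -addnn big_mkcond/=.
  by congr (_ + _)%N; apply: eq_bigr => Y _; case: ifP; rewrite ?mul1n.
rewrite -ltn_double !E.
have tc (Y : {set I}) : i \in Y -> #|Y| = #|toggle i Y|.+1.
  move=> iY; rewrite (cardsD1 i) iY add1n; congr (#|pred_of_set _|).+1.
  by apply/setP => j; rewrite !inE; case: eqVneq => [->|]//=; rewrite iY.
have le (Y : {set I}) : ((Y \in compress i F) * #|Y|
    + (toggle i Y \in compress i F) * #|toggle i Y|
  <= (Y \in F) * #|Y| + (toggle i Y \in F) * #|toggle i Y|)%N.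
  rewrite !inE eqxx toggleK addTb; case: (boolP (i \in Y)) => [iY|iY] /=.
    rewrite (tc _ iY).
    by case: (Y \in F) (toggle i Y \in F) => [] [] /=; lia.
  have := tc (toggle i Y); rewrite toggleK in_toggle iY => /(_ isT) ->.
  by case: (Y \in F) (toggle i Y \in F) => [] [] /=; lia.
rewrite [ltnLHS](bigD1 X)// [ltnRHS](bigD1 X)//= -addSn leq_add//; last first.
  by apply: leq_sum => Y _; exact: le.
rewrite !inE eqxx toggleK iX XF (negbTE tXF)/= (tc _ iX); lia.
Qed.

Definition down_closed F := forall X i, X \in F -> i \in X -> X :\ i \in F.

(** Among the families with the size of [F] and at least its energy, one of least total cardinality
    works: otherwise a compression would lower that total further. *)
Lemma exists_down_closed g F : {homo g : a b / (a <= b)%N >-> b <= a} ->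
  exists G : {set {set I}},
    [/\ #|G| = #|F|, down_closed G & energy g F <= energy g G].
Proof.
move=> gle.
pose Q := [pred G : {set {set I}} |
  (#|G| == #|F|) && (energy g F <= energy g G)].
have QF : Q F by rewrite /= eqxx lexx.
case: (@arg_minnP _ F Q (fun G => \sum_(Y in G) #|Y|)%N QF) => G.
move=> /andP[/eqP cG eG] Gmin; exists G; split => // X i XG iX.
apply/negPn/negP => XiG.
have tX : toggle i X = X :\ i.
  by apply/setP => j; rewrite !inE; case: eqVneq => [->|]//=; rewrite iX.
have := compress_weight XG iX; rewrite tX => /(_ XiG).
rewrite ltnNge => /negP; apply; apply: Gmin.
by rewrite /Q/= card_compress cG eqxx (le_trans eG)// energy_compress.
Qed.

(** Every subset [Y] of [X] lies in [F], by removing the elements of [X :\: Y] one at a time. *)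
Lemma down_closed_card F X : down_closed F -> X \in F -> (2 ^ #|X| <= #|F|)%N.
Proof.
move=> dF XF; rewrite -card_powerset; apply: subset_leq_card.
apply/fintype.subsetP => Y; rewrite powersetE.
move Ek : #|X :\: Y| => k; elim: k => [|k IH] in X XF Ek * => YX.
  suff -> : Y = X by [].
  by apply/eqP; rewrite finset.eqEsubset YX -finset.setD_eq0 -cards_eq0 Ek.
have /card_gt0P[i] : (0 < #|X :\: Y|)%N by rewrite Ek.
rewrite !inE => /andP[iY iX]; apply: (IH (X :\ i)); first exact: dF.
  move: Ek; rewrite (cardsD1 i) !inE iY iX => -[<-].
  congr #|pred_of_set _|; apply/setP => j; rewrite !inE.
  by case: (j == i) (j \in X) (j \in Y) => [] [] [].
apply/fintype.subsetP => j jY; rewrite !inE (fintype.subsetP YX)// andbT.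
by apply: contraNneq iY => <-.
Qed.
End Compression.

(** * Counting pairs at a given distance *)

Section PairCounting.
Variables (R : realType) (I : finType).
Implicit Types (X Y : {set I}) (F : {set {set I}}) (g : nat -> R).

Lemma hdistE X Y : hdist X Y = (#|X :\: Y| + #|Y :\: X|)%N.
Proof.
rewrite /hdist -cardsUI [X in (_ + X)%N](_ : _ = 0%N) ?addn0.
  apply: eq_card => j; rewrite !inE.
  by case: (j \in X) (j \in Y) => [] [].
apply/eqP; rewrite cards_eq0; apply/eqP/setP => j; rewrite !inE.
by case: (j \in X) (j \in Y) => [] [].
Qed.

Lemma hdist_eq0 X Y : (hdist X Y == 0%N) = (Y == X).
Proof.
rewrite hdistE addn_eq0 !cards_eq0 !finset.setD_eq0.
by rewrite [RHS]finset.eqEsubset andbC.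
Qed.

(** The weight factors over the points [j]: membership in [Y] contributes [1 + t] for [j] in [X] and
    [1 + s] outside. *)
Lemma sum_set_weights X (t s : R) :
  \sum_Y t ^+ #|X :\: Y| * s ^+ #|Y :\: X|
  = (1 + t) ^+ #|X| * (1 + s) ^+ #|~: X|.
Proof.
have powE (A : {set I}) (x : R) :
    x ^+ #|A| = \prod_j (if j \in A then x else 1).
  by rewrite -prodr_const big_mkcond.
have -> : (1 + t) ^+ #|X| * (1 + s) ^+ #|~: X|
    = \prod_j ((if j \in X then 1 else s) + (if j \in X then t else 1)).
  rewrite !powE -big_split; apply: eq_bigr => j _ /=.
  by rewrite inE; case: (j \in X); rewrite ?mul1r ?mulr1//= addrC.
rewrite bigA_distr; apply: eq_bigr => Y _; rewrite !powE -big_split/=.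
apply: eq_bigr => j _; rewrite !inE.
by case: (j \in X) (j \in Y) => [] []; rewrite /= ?mul1r ?mulr1.
Qed.

(* Exponential Markov bound: [Y] gets the weight [t ^ #|X\Y| * s ^ #|Y\X|] with
   [t = L sqrt (n / l)] and [s = L sqrt (l / n)], which is at least [L ^ w] as
   soon as [#|Y\X| <= #|X\Y|]; the choice [L = w / (2 sqrt (n l))] is
   optimal. *)
Lemma card_sphere_half X (l w : nat) :
  (#|X| <= l)%N -> (0 < l)%N -> (l <= #|I|)%N ->
  #|[set Y | (hdist X Y == w) && (#|Y :\: X| <= #|X :\: Y|)%N]|%:R
  <= (2 * expR 1 * Num.sqrt (#|I|%:R * l%:R) / w%:R) ^+ w :> R.
Proof.
move=> Xl l0 ln; case: w => [|w].
  (* For [w = 0] the power is 1 whatever its base, and only [Y = X] is at distance 0. *)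
  rewrite expr0 lern1 -(cards1 X); apply: subset_leq_card.
  by apply/fintype.subsetP => Y; rewrite !inE hdist_eq0 => /andP[].
have weight_ge (x v : R) a b : 0 < x -> 1 <= v -> (b <= a)%N ->
    x ^+ (a + b) <= (x * v) ^+ a * (x / v) ^+ b.
  move=> x0 v1 ba; have v0 : 0 < v by exact: lt_le_trans v1.
  rewrite exprMn expr_div_n exprD mulrACA.
  rewrite ler_peMr ?mulr_ge0 ?exprn_ge0 ?(ltW x0)//.
  by rewrite ler_pdivlMr ?exprn_gt0// mul1r ler_weXn2l.
set n := #|I| in ln *; set W := w.+1.
have n0 : (0 < n)%N by exact: leq_trans ln.
pose sn : R := Num.sqrt n%:R; pose sl : R := Num.sqrt l%:R.
have sn0 : 0 < sn by rewrite sqrtr_gt0 ltr0n.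
have sl0 : 0 < sl by rewrite sqrtr_gt0 ltr0n.
have snn : sn * sn = n%:R by rewrite -expr2 sqr_sqrtr ?ler0n.
have sll : sl * sl = l%:R by rewrite -expr2 sqr_sqrtr ?ler0n.
rewrite sqrtrM ?ler0n// -/sn -/sl.
pose L := W%:R / (2 * (sn * sl)).
have L0 : 0 < L by rewrite divr_gt0 ?ltr0n// !mulr_gt0.
pose u := sn / sl.
have u1 : 1 <= u by rewrite ler_pdivlMr// mul1r ler_wsqrtr// ler_nat.
have u0 : 0 < u by exact: lt_le_trans u1.
have -> : 2 * expR 1 * (sn * sl) / W%:R = expR 1 / L.
  by rewrite /L; field; rewrite ?gt_eqF ?ltr0n.
rewrite expr_div_n ler_pdivlMr ?exprn_gt0//.
(* Both summands of the exponent equal [L * (sn * sl)], which is half of [W]. *)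
have -> : expR 1 ^+ W = expR (L * u * l%:R + L / u * n%:R) :> R.
  rewrite -expRM_natl; congr expR; rewrite -sll -snn /L /u; field.
  by rewrite ?gt_eqF.
apply: (@le_trans _ _ (\sum_Y (L * u) ^+ #|X :\: Y| * (L / u) ^+ #|Y :\: X|)).
  rewrite mulr_natl -sumr_const big_mkcond; apply: ler_sum => Y _.
  have s0 : 0 < L / u by rewrite divr_gt0.
  case: ifPn => [|_]; last by rewrite mulr_ge0// exprn_ge0// ltW// mulr_gt0.
  rewrite inE hdistE => /andP[/eqP <-]; move: #|_| #|_| => a b ba.
  exact: weight_ge.
rewrite sum_set_weights expRD.
have pow x (k k' : nat) : 0 < x -> (k <= k')%N ->
    (1 + x) ^+ k <= expR (x * k'%:R) :> R.
  move=> x0 kk'; rewrite mulrC expRM_natl.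
  apply: (@le_trans _ _ (expR x ^+ k)).
    by rewrite lerXn2r ?nnegrE ?expR_ge0 ?expR_ge1Dx// addr_ge0// ltW.
  by rewrite ler_weXn2l// -expR0 ler_expR ltW.
have t0 : 0 < L * u by exact: mulr_gt0.
have s0 : 0 < L / u by exact: divr_gt0.
apply: ler_pM.
- by rewrite exprn_ge0// addr_ge0// ltW.
- by rewrite exprn_ge0// addr_ge0// ltW.
- exact: pow.
- by apply: pow => //; exact: max_card.
Qed.

Lemma energy_le F g : (forall w, 0 <= g w) ->
  {homo g : a b / (a <= b)%N >-> b <= a} ->
  energy g F <= #|F|%:R * \sum_(0 <= w < (up_log 2 #|F|).+1)
     2 * (8 * expR 1 * Num.sqrt (#|I|%:R * (up_log 2 #|F|)%:R) / w%:R) ^+ w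
       * g w.
Proof.
move=> g0 gle; set l := up_log 2 #|F|.
have [G [cG dG /le_trans]] := exists_down_closed F gle; apply.
have Gl : (#|G| <= 2 ^ l)%N by rewrite cG; exact: up_logP.
have ln : (l <= #|I|)%N.
  apply: up_log_min => //; rewrite (leq_trans (max_card _))//.
  by rewrite -cardsT -powersetT card_powerset cardsT.
have Xl X : X \in G -> (#|X| <= l)%N.
  by move=> XG; rewrite -(@leq_exp2l 2)// (leq_trans (down_closed_card dG XG)).
rewrite -cG.
pose B w : R := (8 * expR 1 * Num.sqrt (#|I|%:R * l%:R) / w%:R) ^+ w.
(* Distances from [l] on are split off; there [g] is at most [g l]. *)
pose gs w := if (w < l)%N then g w else 0.
pose lo X Y := (#|Y :\: X| <= #|X :\: Y|)%N.
have gs0 w : 0 <= gs w by rewrite /gs; case: ifP.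
have hdistC X Y : hdist X Y = hdist Y X by rewrite !hdistE addnC.
have le1 : energy g G <= energy gs G + \sum_(X in G) \sum_(Y in G) g l.
  rewrite /energy -big_split; apply: ler_sum => X _ /=.
  rewrite -big_split; apply: ler_sum => Y _ /=; rewrite /gs.
  by case: ltnP => h; rewrite ?add0r ?gle// lerDl.
(* At least one of [lo X Y] and [lo Y X] holds, whence the factor 2. *)
have le2 : energy gs G
    <= (\sum_(X in G) \sum_(Y in G) (lo X Y)%:R * gs (hdist X Y)) *+ 2.
  rewrite mulr2n [in X in _ + X]exchange_big/= -big_split.
  apply: ler_sum => X _ /=; rewrite -big_split; apply: ler_sum => Y _ /=.
  rewrite (hdistC Y X) -mulrDl ler_peMl// /lo.
  by case: (leqP #|Y :\: X|) => [|/ltnW ->]; rewrite ?lerDl ?lerDr.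
have le3 X : X \in G ->
    \sum_(Y in G) (lo X Y)%:R * gs (hdist X Y) <= \sum_(0 <= w < l) B w * g w.
  move=> XG.
  apply: (@le_trans _ _ (\sum_Y \sum_(0 <= w < l)
      ((hdist X Y == w) && lo X Y)%:R * g w)).
    rewrite big_mkcond; apply: ler_sum => Y _ /=.
    have -> : \sum_(0 <= w < l) ((hdist X Y == w) && lo X Y)%:R * g w
        = (lo X Y)%:R * gs (hdist X Y).
      rewrite big_mkord /gs; case: ltnP => h; last first.
        rewrite mulr0 big1// => w _; rewrite gtn_eqF ?mul0r//.
        exact: leq_trans h.
      rewrite (bigD1 (Ordinal h))//= eqxx big1 ?addr0// => w /eqP wh.
      by case: eqP => [e|]; rewrite ?mul0r//; case: wh; apply: val_inj.
    by case: ifP => // _; rewrite mulr_ge0.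
  rewrite exchange_big/= ler_sum_nat// => w /andP[_ wl].
  rewrite -mulr_suml ler_wpM2r//.
  have l0 : (0 < l)%N by exact: leq_trans wl.
  apply: (le_trans _ (le_trans (card_sphere_half w (Xl _ XG) l0 ln) _)).
    rewrite -natr_sum ler_nat -sum1_card [leqRHS]big_mkcond/=.
    by apply: leq_sum => Y _; rewrite inE; case: ifP.
  (* The constant 2 of [card_sphere_half] is relaxed to 8. *)
  apply: lerXn2r; rewrite ?nnegrE ?divr_ge0 ?mulr_ge0 ?expR_ge0 ?sqrtr_ge0//.
  rewrite ler_wpM2r ?invr_ge0 ?ler0n// ler_wpM2r ?sqrtr_ge0//.
  by rewrite ler_wpM2r ?expR_ge0// ler_nat.
(* If [l > 0], then [l <= #|I|] makes the base of [B l] at least [8 e], hence at least 2. If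
   [l = 0], then [B l] is 1 and [G] has at most one member. *)
have le4 : #|G|%:R <= 2 * B l.
  apply: (@le_trans _ _ (2 ^+ l)); first by rewrite -natrX ler_nat.
  have [->|l0] := posnP l; first by rewrite /B !expr0; lra.
  apply: (@le_trans _ _ (B l)); last first.
    by rewrite ler_peMl ?ler1n// exprn_ge0// divr_ge0 ?mulr_ge0 ?expR_ge0.
  apply: lerXn2r; rewrite ?nnegrE ?divr_ge0 ?mulr_ge0 ?expR_ge0 ?sqrtr_ge0//.
  rewrite ler_pdivlMr ?ltr0n//.
  have h1 : 1 <= expR 1 :> R by rewrite -expR0 ler_expR.
  have h2 : l%:R <= Num.sqrt (#|I|%:R * l%:R) :> R.
    rewrite -(@ler_pXn2r _ 2) ?nnegrE ?sqrtr_ge0//.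
    by rewrite sqr_sqrtr ?mulr_ge0// expr2 ler_wpM2r ?ler_nat.
  have := ler_pM ler01 (ler0n R l) h1 h2; rewrite mul1r -!mulrA.
  by have := ler0n R l; lra.
apply: (le_trans le1); rewrite (le_trans (lerD le2 (lexx _)))//.
rewrite big_nat_recr//= mulrDr lerD//.
  have -> : \sum_(0 <= w < l) 2 * B w * g w
      = 2 * \sum_(0 <= w < l) B w * g w.
    by rewrite mulr_sumr; apply: eq_bigr => w _; rewrite mulrA.
  rewrite -[leLHS]mulr_natl [leRHS]mulrCA ler_wpM2l//.
  by rewrite mulr_natl -sumr_const; apply: ler_sum.
rewrite !sumr_const -[leLHS]mulr_natl -[X in _ * X <= _]mulr_natl ler_wpM2l//.
by rewrite ler_wpM2r.
Qed.
End PairCounting.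

(** * Moments of functions of a finite-valued variable *)

Section FiniteExpectation.
Local Open Scope classical_set_scope.
Variables (d : measure_display) (T : measurableType d) (R : realType).
Variables (P : probability T R) (O : finType) (omega : T -> O).
Hypothesis momega : forall v, measurable (omega @^-1` [set v]).

Lemma expectation_finite (f : O -> R) :
  'E_P[f \o omega]%E = (\sum_v f v * fine (P (omega @^-1` [set v])))%:E.
Proof.
have int1 v : P.-integrable setT (fun t => (\1_(omega @^-1` [set v]) t)%:E).
  by apply: integrable_indic => //; exact: fin_num_measure.
rewrite unlock (@eq_integral _ _ _ _ _ (fun t =>
    (\sum_v (f v)%:E * (\1_(omega @^-1` [set v]) t)%:E)%E)); last first.
  move=> t _; rewrite (bigD1 (omega t))//= big1 => [|v /eqP vt].
    by rewrite adde0 indicE mem_set//= mule1.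
  by rewrite indicE memNset ?mule0// => /= tv; apply: vt.
rewrite integral_sum//; last by move=> v; exact: integrableZl.
rewrite -sumEFin; apply: eq_bigr => v _.
rewrite integralZl// integral_indic// setIT EFinM fineK//.
exact: fin_num_measure.
Qed.

Lemma sum_fibers : \sum_v fine (P (omega @^-1` [set v])) = 1.
Proof.
have := expectation_finite (fun=> 1).
rewrite (_ : _ \o _ = cst 1)// expectation_cst => -[->].
by apply: eq_bigr => v _; rewrite mul1r.
Qed.

(** The squared deviation is again a function of [omega], so [expectation_finite] applies a second
    time, and the square is expanded inside a finite sum. *)
Lemma variance_finite (f : O -> R) :
  let E (g : O -> R) := \sum_v g v * fine (P (omega @^-1` [set v])) in
  ('V_P[f \o omega] = (E (fun v => f v ^+ 2) - E f ^+ 2)%:E)%E.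
Proof.
move=> E; rewrite /variance unlock expectation_finite/=.
rewrite (_ : _ * _ = (fun v => (f v - E f) ^+ 2) \o omega)//.
rewrite expectation_finite; congr EFin.
have expand m (w : O -> R) : \sum_v (f v - m) ^+ 2 * w v
    = \sum_v f v ^+ 2 * w v - 2 * m * (\sum_v f v * w v) + m ^+ 2 * \sum_v w v.
  rewrite !mulr_sumr -sumrB -big_split; apply: eq_bigr => v _ /=; ring.
by rewrite expand sum_fibers -/(E f) -/(E (fun v => f v ^+ 2)); ring.
Qed.
End FiniteExpectation.

(** * The nontrivial character of the field with two elements *)

Section SignCharacter.
Variable R : numFieldType.

Definition sgF2 (u : 'F_2) : R := if u == 0 then 1 else -1.

Lemma F2_bool (u : 'F_2) : u = (u != 0)%:R.
Proof. by apply/val_inj; case: u => [[|[|]]]. Qed.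

Lemma sgF2D : {morph sgF2 : u v / u + v >-> u * v}.
Proof.
move=> u v; rewrite (F2_bool u) (F2_bool v) /sgF2.
by case: (u != 0) (v != 0) => [] [] /=; rewrite ?mulrNN ?mulr1 ?mul1r.
Qed.

Lemma sgF2_sum (I : Type) (s : seq I) (f : I -> 'F_2) :
  sgF2 (\sum_(j <- s) f j) = \prod_(j <- s) sgF2 (f j).
Proof. by rewrite (big_morph sgF2 sgF2D (erefl : sgF2 0 = 1)). Qed.

(** Fourier expansion of the indicator of 0; it turns a linear condition into a product over
    coordinates. *)
Lemma F2_eq0 (u : 'F_2) : (u == 0)%:R = 2^-1 * (1 + sgF2 u) :> R.
Proof.
by rewrite /sgF2; case: eqP => _ /=; rewrite ?subrr ?mulr0 ?mulVf ?pnatr_eq0.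
Qed.

Lemma sum_bool (f : bool -> R) : \sum_b f b = f true + f false.
Proof. by rewrite (bigD1 true)//= (big_pred1 false)// => [][]. Qed.
End SignCharacter.

(** * Collision probability for a single row *)

Section HashRow.
Variables (R : realType) (n : nat).
Implicit Types (x y : 'cV['F_2]_n) (u : {ffun 'I_n -> bool} * bool) (c : 'F_2).

Definition supp x : {set 'I_n} := [set j | x j 0 != 0]%SET.

Lemma supp_inj : injective supp.
Proof.
move=> x y /setP xy; apply/matrixP => i j; rewrite ord1.
by rewrite [LHS]F2_bool [RHS]F2_bool; move: (xy i); rewrite !inE => ->.
Qed.

Definition row_hash u x : 'F_2 := \sum_j (u.1 j)%:R * x j 0 + u.2%:R.

Definition row_weight (p : R) u : R :=
  (\prod_j bernoulli_pmf p (u.1 j)) * bernoulli_pmf 2^-1 u.2.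

Lemma sum_pmf (p : R) : \sum_b bernoulli_pmf p b = 1.
Proof. by rewrite sum_bool /bernoulli_pmf/=; ring. Qed.

Lemma sum_row_weight p : \sum_u row_weight p u = 1.
Proof.
rewrite -(pair_big xpredT xpredT (fun a b => row_weight p (a, b)))/=.
rewrite /row_weight/=; under eq_bigr do rewrite -mulr_sumr sum_pmf mulr1.
rewrite -(bigA_distr_bigA (fun _ b => bernoulli_pmf p b)).
by rewrite big1// => j _; exact: sum_pmf.
Qed.

(** Given the row [a] of the matrix, the offset bit has exactly one good value if [a] is orthogonal
    to [x - y], and none otherwise. The mean of the sign of that inner product factors over
    coordinates, with a factor [(1 - p) - p] wherever [x] and [y] differ and 1 elsewhere. *)
Lemma row_collision p x y c :
  \sum_u row_weight p u * ((row_hash u x == c) && (row_hash u y == c))%:R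
  = 2^-1 * (2^-1 + 2^-1 * (1 - 2 * p) ^+ hdist (supp x) (supp y)).
Proof.
rewrite -(pair_big xpredT xpredT (fun a b => row_weight p (a, b) *
  ((row_hash (a, b) x == c) && (row_hash (a, b) y == c))%:R))/=.
rewrite /row_weight /row_hash/=.
pose D (a : {ffun 'I_n -> bool}) j : 'F_2 := (a j)%:R * (x j 0 - y j 0).
have step (a : {ffun 'I_n -> bool}) :
    \sum_b (\prod_j bernoulli_pmf p (a j)) * bernoulli_pmf 2^-1 b *
      ((\sum_j (a j)%:R * x j 0 + b%:R == c)
       && (\sum_j (a j)%:R * y j 0 + b%:R == c))%:R
    = 2^-1 * (2^-1 * (\prod_j bernoulli_pmf p (a j)
                 + \prod_j (bernoulli_pmf p (a j) * sgF2 R (D a j)))).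
  rewrite [in RHS]big_split/= -sgF2_sum.
  set m := \prod_j _; set X := \sum_j (a j)%:R * x j 0.
  set Y := \sum_j (a j)%:R * y j 0.
  have -> : \sum_j D a j = X - Y.
    by rewrite -sumrB; apply: eq_bigr => j _; rewrite /D mulrBr.
  have -> : m + m * sgF2 R (X - Y) = m * (1 + sgF2 R (X - Y)) by ring.
  rewrite [X in _ = _ * X]mulrCA -F2_eq0 sum_bool /bernoulli_pmf/= subr_eq0.
  rewrite (F2_bool X) (F2_bool Y) (F2_bool c).
  by case: (X != 0) (Y != 0) (c != 0) => [] [] [] /=; field.
rewrite (eq_bigr _ (fun a _ => step a)) -!mulr_sumr big_split/=.
rewrite -(bigA_distr_bigA (fun _ b => bernoulli_pmf p b)).
rewrite -(bigA_distr_bigA (fun j b => bernoulli_pmf p b *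
  sgF2 R (b%:R * (x j 0 - y j 0)))).
rewrite big1 => [|j _]; last exact: sum_pmf.
rewrite mulrDr mulr1; congr (_ * (_ + _ * _)).
rewrite /hdist -prodr_const [RHS]big_mkcond; apply: eq_bigr => j _.
rewrite sum_bool !inE /bernoulli_pmf/= mul1r mul0r.
rewrite (F2_bool (x j 0)) (F2_bool (y j 0)) /sgF2.
by case: (x j 0 != 0) (y j 0 != 0) => [] [] /=; ring.
Qed.
End HashRow.

(** * Mean and variance of the count *)

Section SparseHash.
Local Open Scope classical_set_scope.
Local Open Scope ring_scope.
Variables (d : measure_display) (T : measurableType d) (R : realType).
Variables (P : probability T R) (n : nat) (p : 'I_n -> R).
Hypothesis hp : forall i, 0 < p i <= 2^-1.
Variable h : sparse_hash P p.

Let outcome := {ffun 'I_n -> {ffun 'I_n -> bool} * bool}.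

(** Gathers all random bits in one finite-valued variable, so that moments of [Cnt] become finite
    sums. *)
Definition rows (t : T) : outcome :=
  [ffun i => ([ffun j => entryA h (i, j) t], entryb h i t)].

Let entry (k : 'I_n * 'I_n + 'I_n) : {RV P >-> bool} :=
  match k with inl ij => entryA h ij | inr i => entryb h i end.

Let value (v : outcome) (k : 'I_n * 'I_n + 'I_n) : bool :=
  match k with inl (i, j) => (v i).1 j | inr i => (v i).2 end.

(** Puts a fibre in the form required by [entry_indep], with [J] the full index set. *)
Lemma rows_fiber (v : outcome) : rows @^-1` [set v]
  = \bigcap_(k in [set` [set: 'I_n * 'I_n + 'I_n]%SET])
       (entry k @^-1` [set value v k]).
Proof.
apply/seteqP; split => t /=.
  by move=> <- [[i j]|i] _ /=; rewrite !ffunE.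
move=> H; apply/ffunP => i; rewrite !ffunE; apply: injective_projections => /=.
  by apply/ffunP => j; rewrite ffunE; apply: (H (inl (i, j))); rewrite /= inE.
by apply: (H (inr i)); rewrite /= inE.
Qed.

Lemma measurable_rows (v : outcome) : measurable (rows @^-1` [set v]).
Proof.
rewrite rows_fiber; apply: fin_bigcap_measurable; first exact: finite_finset.
by move=> k _; exact: measurable_funPTI.
Qed.

Lemma bernoulli_prob_set1 (q : R) b : 0 <= q <= 1 ->
  bernoulli_prob q [set b] = (bernoulli_pmf q b)%:E.
Proof.
move=> q01; rewrite bernoulli_probE// !diracE /bernoulli_pmf.
case: b.
  by rewrite (@mem_set _ _ true)// (@memNset _ _ false)// mule1 mule0 adde0.
by rewrite (@memNset _ _ true)// (@mem_set _ _ false)// mule0 mule1 add0e.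
Qed.

Lemma prob_rows (v : outcome) :
  P (rows @^-1` [set v]) = (\prod_i row_weight (p i) (v i))%:E.
Proof.
rewrite rows_fiber (entry_indep h)//.
transitivity (\prod_k (match k with
  | inl (i, j) => bernoulli_pmf (p i) ((v i).1 j)
  | inr i => bernoulli_pmf 2^-1 (v i).2 end))%:E.
  rewrite -prodEFin; apply: eq_big => [k|[[i j]|i] _]; first by rewrite inE.
    rewrite -bernoulli_prob_set1 -?(entryA_distr h i j)//.
    by have := hp i; lra.
  by rewrite -bernoulli_prob_set1 -?(entryb_distr h i)//; lra.
congr EFin; rewrite big_sumType/= /row_weight big_split/=; congr (_ * _).
by rewrite pair_bigA/=; apply: eq_bigr => -[].
Qed.

Variables (m : nat) (hmn : (m <= n)%N) (alpha : 'cV['F_2]_n).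

Definition hits (v : outcome) (x : 'cV['F_2]_n) : bool :=
  [forall j : 'I_m, row_hash (v (widen_ord hmn j)) x
                    == alpha (widen_ord hmn j) 0].

Lemma hash_prefixE t x :
  (hash_prefix h hmn t x == first_rows hmn alpha) = hits (rows t) x.
Proof.
have E j : hash_prefix h hmn t x j 0 = row_hash (rows t (widen_ord hmn j)) x.
  rewrite !mxE /row_hash !ffunE/=; congr (_ + _); apply: eq_bigr => k _.
  by rewrite !mxE !ffunE.
apply/eqP/forallP => [H j|H]; first by rewrite -E H mxE.
by apply/matrixP => j k; rewrite ord1 E (eqP (H j)) mxE.
Qed.

(** The sum factors over rows: each of the first [m] gives [row_collision], each later one has total
    weight 1. The case [x = y] serves for the mean. *)
Lemma prob_hits2 x y :
  \sum_v (hits v x && hits v y)%:R * fine (P (rows @^-1` [set v]))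
  = 2 ^- m * q p (hdist (supp x) (supp y)) hmn.
Proof.
pose Q i u := (row_hash u x == alpha i 0) && (row_hash u y == alpha i 0).
have E (v : outcome) : (hits v x && hits v y)%:R * fine (P (rows @^-1` [set v]))
    = \prod_i (row_weight (p i) (v i)
               * (if (i < m)%N then (Q i (v i))%:R else 1)) :> R.
  rewrite prob_rows/= [RHS]big_split/= [LHS]mulrC; congr (_ * _).
  rewrite -big_mkcond/= big_ord_narrow.
  have -> : hits v x && hits v y
      = [forall j : 'I_m, Q (widen_ord hmn j) (v (widen_ord hmn j))].
    apply/andP/forallP => [[/forallP Hx /forallP Hy] j|H].
      by rewrite /Q Hx Hy.
    by split; apply/forallP => j; have /andP[] := H j.
  case: forallP => [H|/forallP]; first by rewrite big1// => j _; rewrite H.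
  rewrite negb_forall => /existsP[j /negbTE Hj].
  by rewrite (bigD1 j)//= Hj mul0r.
rewrite (eq_bigr _ (fun v _ => E v)).
rewrite -(bigA_distr_bigA (fun i u => row_weight (p i) u *
  (if (i < m)%N then (Q i u)%:R else 1))).
pose w := hdist (supp x) (supp y).
transitivity (\prod_(i < n) if (i < m)%N then
    2^-1 * (2^-1 + 2^-1 * (1 - 2 * p i) ^+ w) else 1).
  apply: eq_bigr => i _; case: ifP => _; first exact: row_collision.
  by under eq_bigr do rewrite mulr1; exact: sum_row_weight.
by rewrite -big_mkcond/= big_ord_narrow big_split/= prodr_const card_ord exprVn.
Qed.

Variable S : {set 'cV['F_2]_n}.

Definition hit_count (v : outcome) : R := \sum_(x in S) (hits v x)%:R.

Lemma CntE : Cnt h hmn alpha S = hit_count \o rows.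
Proof.
apply/funext => t; rewrite /Cnt /hit_count/= -natr_sum; congr _%:R.
rewrite -sum1_card [LHS]big_mkcond [RHS]big_mkcond/=; apply: eq_bigr => x _.
by rewrite inE hash_prefixE; case: (x \in S) (hits _ _) => [] [].
Qed.

Lemma q0 : q p 0 hmn = 1.
Proof. by rewrite /q big1// => j _; rewrite expr0; lra. Qed.

Lemma expectation_Cnt : 'E_P[Cnt h hmn alpha S]%E = (#|S|%:R * 2 ^- m)%:E.
Proof.
rewrite CntE (expectation_finite P measurable_rows); congr EFin.
under eq_bigr do rewrite /hit_count mulr_suml.
rewrite exchange_big/= mulr_natl -sumr_const; apply: eq_bigr => x _.
under eq_bigr do rewrite -[hits _ _]andbb.
by rewrite prob_hits2 (eqP (_ : hdist _ _ == 0%N)) ?hdist_eq0// q0 mulr1.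
Qed.

(** The squared mean is spread over the pairs as [2 ^- m * 2 ^- m], which turns [q] into [r] term by
    term. *)
Lemma variance_Cnt : ('V_P[Cnt h hmn alpha S])%E
  = (2 ^- m * \sum_(x in S) \sum_(y in S) r p (hdist (supp x) (supp y)) hmn)%:E.
Proof.
have := expectation_Cnt; rewrite CntE (variance_finite P measurable_rows)/=.
rewrite (expectation_finite P measurable_rows) => -[->]; congr EFin.
have -> : \sum_v hit_count v ^+ 2 * fine (P (rows @^-1` [set v]))
    = \sum_(x in S) \sum_(y in S) 2 ^- m * q p (hdist (supp x) (supp y)) hmn.
  under eq_bigr do rewrite expr2 /hit_count mulr_suml mulr_suml.
  rewrite exchange_big/=; apply: eq_bigr => x _.
  under eq_bigr do rewrite mulr_sumr mulr_suml.
  rewrite exchange_big/=; apply: eq_bigr => y _.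
  by rewrite -prob_hits2; apply: eq_bigr => v _; rewrite -natrM mulnb.
have -> : (#|S|%:R * 2 ^- m) ^+ 2
    = \sum_(x in S) \sum_(y in S) 2 ^- m * 2 ^- m :> R.
  by rewrite !sumr_const -[RHS]mulr_natl -[X in _ = _ * X]mulr_natl; ring.
rewrite -sumrB mulr_sumr; apply: eq_bigr => x _.
by rewrite -sumrB mulr_sumr; apply: eq_bigr => y _; rewrite /r mulrBr.
Qed.
End SparseHash.

(** * Sign and monotonicity of [r], and the final bound *)

Section Weights.
Variables (R : realType) (n : nat) (p : 'I_n -> R).
Hypothesis hp : forall i, 0 < p i <= 2^-1.
Variables (m : nat) (hmn : (m <= n)%N).

(** As [p j <= 1/2], no power of [1 - 2 * p j] is negative, so every factor of [q] is at least
    [1/2]. *)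
Lemma r_ge0 w : 0 <= r p w hmn.
Proof.
rewrite subr_ge0 /q -exprVn -[X in _ ^+ X](card_ord m) -prodr_const.
apply: ler_prod => j _; rewrite invr_ge0 ler0n lerDl.
by rewrite mulr_ge0// exprn_ge0//; have := hp (widen_ord hmn j); lra.
Qed.

Lemma r_nonincreasing :
  {homo (fun w => r p w hmn) : a b / (a <= b)%N >-> b <= a}.
Proof.
move=> a b ab; rewrite lerB// /q; apply: ler_prod => j _.
have Hp := hp (widen_ord hmn j).
have x0 : 0 <= 1 - 2 * p (widen_ord hmn j) by lra.
have x1 : 1 - 2 * p (widen_ord hmn j) <= 1 by lra.
rewrite addr_ge0 ?mulr_ge0 ?exprn_ge0//= lerD2l ler_wpM2l//.
exact: ler_wiXn2l.
Qed.
End Weights.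

(* For w = 0 the base of the power is x / 0 = 0 and 0 ^+ 0 = 1, so the summand
   is 2 * r p 0 hmn. *)
Theorem theorem1 (d : measure_display) (T : measurableType d) (R : realType)
    (P : probability T R) (n : nat) (p : 'I_n -> R)
    (hp : forall i, 0 < p i <= 2^-1) (h : sparse_hash P p)
    (alpha : 'cV['F_2]_n) (m : nat) (hm : (1 <= m)%N) (hmn : (m <= n)%N)
    (S : {set 'cV['F_2]_n}) (hS : S != finset.set0) :
  let ell := up_log 2 #|S| in
  ('V_P[Cnt h hmn alpha S] / 'E_P[Cnt h hmn alpha S]
   <= (\sum_(0 <= w < ell.+1)
         2 * (8 * expR 1 * Num.sqrt (n%:R * ell%:R) / w%:R) ^+ w
           * r p w hmn)%R%:E)%E.
Proof.
cbv zeta; rewrite (variance_Cnt hp) (expectation_Cnt hp).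
have S0 : 0 < #|S|%:R :> R by rewrite ltr0n card_gt0.
have m0 : 0 < 2 ^- m :> R by rewrite invr_gt0 exprn_gt0.
(* The mean is nonzero since [S] is nonempty, so the extended-real quotient is a real one. *)
rewrite inver gt_eqF ?mulr_gt0// -EFinM lee_fin ler_pdivrMr ?mulr_gt0//.
(* Vectors become their supports; [supp] is injective, so the size of [S] and the sum over pairs
   carry over, and [2 ^- m] cancels. *)
have := energy_le (@supp n @: S)%SET (r_ge0 hp hmn) (r_nonincreasing hp hmn).
have injS : {in S &, injective (@supp n)} by move=> x y _ _; exact: supp_inj.
rewrite card_in_imset ?card_ord// /energy big_imset//=.
under eq_bigr do rewrite big_imset//=.
by move=> le; rewrite mulrA [leLHS]mulrC ler_pM2r// [leRHS]mulrC.
Qed.
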